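(* The following hold for the Laplacian spectral radius $\mu$. (1) Let $k\geq 1$ and $n\geq 2k+2$ be integers and let $G$ be a $C_4$-free $k$-cyclic graph of order $n$. Then $\mu(G)\leq\mu(G_n^k)$, with equality if and only if $G=G_n^k$ (up to isomorphism). (2) Let $n\geq 6$ and let $U_n$ be the set of $C_4$-free unicyclic graphs of order $n$. For any $G\in U_n$ not isomorphic to any of the graphs $G_1,G_2,G_3$ of order $n$ defined in the context, $\mu(G)<\mu(G_3)<\mu(G_2)<\mu(G_1)$. (3) Let $n\geq 8$ and let $B_n$ be the set of $C_4$-free bicyclic graphs of order $n$. For any $G\in B_n$ not isomorphic to any of the graphs $G_4,G_5,G_6$ of order $n$ defined in the context, $\mu(G)<\mu(G_6)<\mu(G_5)<\mu(G_4)$.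
   Context: All graphs are finite and simple. A $k$-cyclic graph is a connected graph of order $n$ (number of vertices) and size $n+k-1$ (number of edges); unicyclic means $1$-cyclic and bicyclic means $2$-cyclic. A graph is $C_4$-free if it has no (not necessarily induced) subgraph isomorphic to the cycle $C_4$ on 4 vertices. For a graph $G$ with adjacency matrix $A(G)$ and diagonal matrix of vertex degrees $D(G)$, the Laplacian matrix is $L(G)=D(G)-A(G)$ and $\mu(G)$ denotes its largest eigenvalue. The graph $G_n^k=K_1\vee(kK_2\cup(n-2k-1)K_1)$ is the join of a single vertex with the disjoint union of $k$ copies of $K_2$ and $n-2k-1$ isolated vertices. The other graphs, each of order $n$, are: - $G_1=G_n^1$: a triangle with $n-3$ pendant vertices attached to one of its vertices. - $G_2$: a triangle $w,a,b$ with $n-4$ pendant vertices attached to $w$ and one pendant vertex attached to $a$. - $G_3$: a triangle $w,a,b$ with $n-5$ pendant vertices attached to $w$, and a pendant path of length 2 attached at $w$ (a vertex $c$ adjacent to $w$, and a vertex $z$ adjacent only to $c$). - $G_4=G_n^2$: two triangles sharing exactly one common vertex $w$, with $n-5$ pendant vertices attached to $w$. - $G_5$: two triangles sharing exactly one common vertex $w$, with $n-6$ pendant vertices attached to $w$ and one pendant vertex attached to one of the four triangle vertices other than $w$. - $G_6$: two triangles sharing exactly one common vertex $w$, with $n-7$ pendant vertices attached to $w$, and a pendant path of length 2 attached at $w$ (a vertex $c$ adjacent to $w$, and a vertex $z$ adjacent only to $c$). *)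

(* Defs.v *)
From HB Require Import structures.
From mathcomp Require Import all_boot all_order all_algebra.
From mathcomp Require Import classical_sets reals.

Set Implicit Arguments.
Unset Strict Implicit.
Unset Printing Implicit Defensive.

Import Order.TTheory GRing.Theory Num.Theory.

Record sgraph (V : finType) := SGraph {
  adj :> rel V;
  adj_sym : symmetric adj;
  adj_irr : irreflexive adj
}.

Definition iso (V W : finType) (G : sgraph V) (H : sgraph W) : Prop :=
  exists f : V -> W, bijective f /\ forall x y, H (f x) (f y) = G x y.

Definition edges (V : finType) (G : sgraph V) : {set {set V}} :=
  [set [set p.1; p.2] | p in [pred p : V * V | G p.1 p.2]].

Definition degree (V : finType) (G : sgraph V) (x : V) : nat :=
  #|[set y | G x y]|.

Definition connected_graph (V : finType) (G : sgraph V) : Prop :=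
  0 < #|V| /\ forall x y, connect G x y.

Definition kcyclic (k : nat) (V : finType) (G : sgraph V) : Prop :=
  connected_graph G /\ #|edges G| = #|V| + k - 1.

(* H is isomorphic to a (not necessarily induced) subgraph of G. *)
Definition has_subgraph (V W : finType) (H : sgraph W) (G : sgraph V) : Prop :=
  exists f : W -> V, injective f /\ forall x y, H x y -> G (f x) (f y).

Definition complete_rel (V : finType) : rel V := fun x y => x != y.

Fact complete_sym V : symmetric (@complete_rel V).
Proof. by move=> x y; rewrite /complete_rel eq_sym. Qed.

Fact complete_irr V : irreflexive (@complete_rel V).
Proof. by move=> x; rewrite /complete_rel eqxx. Qed.

Definition complete_graph (m : nat) : sgraph 'I_m :=
  SGraph (@complete_sym 'I_m) (@complete_irr 'I_m).

Definition empty_rel (V : finType) : rel V := fun _ _ => false.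

Definition empty_graph (m : nat) : sgraph 'I_m :=
  @SGraph 'I_m (@empty_rel 'I_m) (fun _ _ => erefl) (fun _ => erefl).

Definition C4_rel : rel 'I_4 :=
  fun i j => (j == i.+1 %% 4 :> nat) || (i == j.+1 %% 4 :> nat).

Fact C4_sym : symmetric C4_rel.
Proof. by move=> i j; rewrite /C4_rel orbC. Qed.

Fact C4_irr : irreflexive C4_rel.
Proof. by case=> [[|[|[|[|i]]]] Hi]. Qed.

Definition C4 : sgraph 'I_4 := SGraph C4_sym C4_irr.

Definition C4_free (V : finType) (G : sgraph V) : Prop := ~ has_subgraph C4 G.

Section Operations.
Variables V W : finType.
Variables (G : sgraph V) (H : sgraph W).

Definition union_rel : rel (V + W) := fun x y =>
  match x, y with
  | inl x, inl y => G x y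
  | inr x, inr y => H x y
  | _, _ => false
  end.

Fact union_sym : symmetric union_rel.
Proof. by case=> x [] y //=; apply: adj_sym. Qed.

Fact union_irr : irreflexive union_rel.
Proof. by case=> x /=; apply: adj_irr. Qed.

Definition graph_union : sgraph (V + W)%type := SGraph union_sym union_irr.

Definition join_rel : rel (V + W) := fun x y =>
  match x, y with
  | inl x, inl y => G x y
  | inr x, inr y => H x y
  | _, _ => true
  end.

Fact join_sym : symmetric join_rel.
Proof. by case=> x [] y //=; apply: adj_sym. Qed.

Fact join_irr : irreflexive join_rel.
Proof. by case=> x /=; apply: adj_irr. Qed.

Definition graph_join : sgraph (V + W)%type := SGraph join_sym join_irr.

(* The disjoint union of k copies of G, the copies being indexed by 'I_k. *)
Definition copies_rel (k : nat) : rel ('I_k * V) := fun x y =>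
  (x.1 == y.1) && G x.2 y.2.

Fact copies_sym k : symmetric (@copies_rel k).
Proof. by move=> x y; rewrite /copies_rel eq_sym adj_sym. Qed.

Fact copies_irr k : irreflexive (@copies_rel k).
Proof. by move=> x; rewrite /copies_rel adj_irr andbF. Qed.

Definition copies (k : nat) : sgraph ('I_k * V)%type :=
  SGraph (@copies_sym k) (@copies_irr k).

(* The new vertex None is joined to v and to no other vertex. *)
Definition pendant_rel (v : V) : rel (option V) := fun x y =>
  match x, y with
  | Some x, Some y => G x y
  | Some x, None => x == v
  | None, Some y => y == v
  | None, None => false
  end.

Fact pendant_sym v : symmetric (pendant_rel v).
Proof. by case=> [x|] [y|] //=; apply: adj_sym. Qed.

Fact pendant_irr v : irreflexive (pendant_rel v).
Proof. by case=> [x|] //=; apply: adj_irr. Qed.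

Definition add_pendant (v : V) : sgraph (option V) :=
  SGraph (pendant_sym v) (pendant_irr v).

End Operations.

(* The join of K_1 with the union of k K_2 and m K_1: k triangles sharing exactly one common vertex,
   with m pendant vertices attached to it. *)
Definition windmill_vertex (k m : nat) : finType :=
  ('I_1 + ('I_k * 'I_2 + 'I_m))%type.

Definition windmill (k m : nat) : sgraph (windmill_vertex k m) :=
  graph_join (complete_graph 1)
    (graph_union (copies (complete_graph 2) k) (empty_graph m)).

Definition windmill_center (k m : nat) : windmill_vertex k m := inl ord0.

(* All triangle vertices other than the center are equivalent under
   automorphisms, so the choice made here is immaterial. *)
Definition windmill_triangle_vertex (k m : nat) : windmill_vertex k.+1 m :=
  inr (inl (ord0, ord0)).

Definition Gnk (n k : nat) : sgraph (windmill_vertex k (n - 2 * k - 1)) :=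
  windmill k (n - 2 * k - 1).

(* In G3 and G6 the vertex c is attached first, as a pendant vertex at w;
   it then becomes None, and z is attached to it. *)
Definition G1 (n : nat) := Gnk n 1.
Definition G2 (n : nat) :=
  add_pendant (windmill 1 (n - 4)) (windmill_triangle_vertex 0 (n - 4)).
Definition G3 (n : nat) :=
  add_pendant (add_pendant (windmill 1 (n - 5)) (windmill_center 1 (n - 5))) None.
Definition G4 (n : nat) := Gnk n 2.
Definition G5 (n : nat) :=
  add_pendant (windmill 2 (n - 6)) (windmill_triangle_vertex 1 (n - 6)).
Definition G6 (n : nat) :=
  add_pendant (add_pendant (windmill 2 (n - 7)) (windmill_center 2 (n - 7))) None.

Section Laplacian.
Local Open Scope ring_scope.
Variables (R : realType) (V : finType) (G : sgraph V).

(* Rows and columns follow the enumeration enum_val of the vertices. *)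
Definition adjacency_mx : 'M[R]_#|V| :=
  \matrix_(i, j) (G (enum_val i) (enum_val j))%:R.

Definition degree_mx : 'M[R]_#|V| :=
  diag_mx (\row_i (degree G (enum_val i))%:R).

Definition laplacian_mx : 'M[R]_#|V| := degree_mx - adjacency_mx.

(* The Laplacian is a real symmetric matrix, so its set of eigenvalues is
   finite, and nonempty as soon as V is: the supremum is then a maximum. *)
Definition mu : R := sup [set x : R | eigenvalue laplacian_mx x]%classic.

End Laplacian.

(* Main.v *)
(* The Laplacian and the complement Laplacian add up to n times the identity on functions of sum 0, so mu <= n, and
   mu = n forces the complement to be disconnected. In a C4-free graph this means that some vertex is adjacent to all others,
   and since the other vertices then span a matching, the graph is a windmill.

   If the maximum degree is n - 2, the unique vertex not adjacent to the center w is a pendant vertex hanging from a neighbour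
   of w, and deleting it leaves a windmill: this yields exactly the two exceptional graphs. If the maximum degree is at most
   n - 3, evaluating an eigenfunction at a vertex u where |x u| / degree u is maximal gives
   mu <= d + S / d, where d is the degree of u and S the sum of the degrees of its neighbours. As two vertices have at most
   one common neighbour, S <= d + n - 1, and counting edges gives S <= n - 1 + 2k; hence mu <= n - 1, apart from one critical
   case that is settled by looking at a triangle at u. The exceptional graphs have mu > n - 1, and they are compared through
   the polynomials having their eigenvalues above n - 1 as roots. *)
Require Import Defs.
From mathcomp Require Import all_boot all_order all_algebra perm.
From mathcomp Require Import reals.
From mathcomp Require Import zify ring lra.

Set Implicit Arguments.
Unset Strict Implicit.
Unset Printing Implicit Defensive.

Import Order.TTheory GRing.Theory Num.Theory.

(** * Graphs, isomorphisms and vertex deletion *)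

Section Graph.
Variables (V : finType) (G : sgraph V).

Lemma adj_neq u v : G u v -> u != v.
Proof. by apply: contraTneq => ->; rewrite adj_irr. Qed.

(** Two distinct common neighbours of u and v would close the 4-cycle u a v b. Nearly every use of
    C4-freeness below takes this form. *)
Lemma C4_free_common u v a b : C4_free G -> u != v ->
  G u a -> G v a -> G u b -> G v b -> a = b.
Proof.
move=> free uv ua va ub vb; apply/eqP/negPn/negP => ab; apply: free.
have [[nua nub] [nva nvb]] := ((adj_neq ua, adj_neq ub), (adj_neq va, adj_neq vb)).
exists (fun i : 'I_4 => nth u [:: u; a; v; b] i); split=> [i j /eqP|].
  rewrite nth_uniq ?ltn_ord // => [/eqP/val_inj //|].
  by rewrite /= !inE !negb_or nua uv nub eq_sym nva ab nvb.
by case=> [[|[|[|[|i]]]] hi] // [[|[|[|[|j]]]] hj] //=; rewrite // adj_sym.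
Qed.

Lemma degreeE u : degree G u = \sum_v (G u v : nat).
Proof. by rewrite /degree -sum1_card big_mkcond; apply: eq_bigr => v _; rewrite inE; case: (G u v). Qed.

(** Double counting: each degree is the number of edges containing the vertex, and each edge
    contains two vertices. *)
Lemma sum_degree : \sum_u degree G u = 2 * #|edges G|.
Proof.
have degE u : degree G u = \sum_(e in edges G) (u \in e : nat).
  transitivity #|[set [set u; v] | v in [set v | G u v]]|.
    rewrite card_in_imset // => v v'; rewrite !inE => uv uv' E.
    have : v \in [set u; v'] by rewrite -E !inE eqxx orbT.
    by rewrite !inE eq_sym (negbTE (adj_neq uv)) => /eqP.
  rewrite -sum1_card [RHS](bigID (fun e : {set V} => u \in e)) /= [X in _ + X]big1 ?addn0; last first.
    by move=> e /andP[_ /negbTE->].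
  apply: eq_big => [e|e]; last by case/imsetP => v _ ->; rewrite !inE eqxx.
  apply/imsetP/andP => [[v]|[/imsetP[[x y] xy ->]]].
    rewrite inE => uv ->; split; last by rewrite !inE eqxx.
    by apply/imsetP; exists (u, v).
  have {}xy : G x y := xy; rewrite !inE /= => /orP[/eqP->|/eqP->].
    by exists y; rewrite ?inE.
  by exists x; rewrite ?inE 1?adj_sym // setUC.
rewrite (eq_bigr _ (fun u _ => degE u)) exchange_big /= mulnC -sum_nat_const.
apply: eq_bigr => e /imsetP[[x y] xy -> /=]; have {}xy : G x y := xy.
have <- : #|[set x; y]| = 2 by rewrite cards2 (adj_neq xy).
rewrite -sum1_card [RHS]big_mkcond.
by apply: eq_bigr => u _; case: ifP.
Qed.

Lemma kcyclic_sum_degree k : kcyclic k G -> \sum_u degree G u = 2 * (#|V| + k - 1).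
Proof. by case=> _ E; rewrite sum_degree E. Qed.

Lemma connected_degree_gt0 u : 1 < #|V| -> connected_graph G -> 0 < degree G u.
Proof.
move=> V1 [_ con]; have /card_gt0P[v] : 0 < #|[set~ u]| by rewrite cardsC1; lia.
rewrite !inE => vu; have /connectP[[|w p] /= E lst] := con u v.
  by rewrite lst eqxx in vu.
by apply/card_gt0P; exists w; rewrite inE; case/andP: E.
Qed.

End Graph.

Lemma iso_sym (V W : finType) (G : sgraph V) (H : sgraph W) : iso G H -> iso H G.
Proof.
case=> f [[g fK gK] fH]; exists g; split; first by exists f.
by move=> x y; rewrite -fH !gK.
Qed.

Lemma iso_trans (U V W : finType) (F : sgraph U) (G : sgraph V) (H : sgraph W) :
  iso F G -> iso G H -> iso F H.
Proof.
case=> f [fB fE] [g [gB gE]]; exists (g \o f); split; first exact: bij_comp.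
by move=> x y; rewrite /= gE fE.
Qed.

Lemma iso_add_pendant (V W : finType) (G : sgraph V) (H : sgraph W) (f : V -> W) v :
  bijective f -> (forall x y, H (f x) (f y) = G x y) ->
  iso (add_pendant G v) (add_pendant H (f v)).
Proof.
case=> g fK gK fE; exists (omap f); split.
  by exists (omap g) => [[x|]|[x|]] //=; rewrite ?fK ?gK.
by move=> [x|] [y|] //=; rewrite ?fE // (can_eq fK).
Qed.

Section Deletion.
Variables (V : finType) (G : sgraph V) (z : V).

Definition del_rel : rel {x | x != z} := fun x y => G (val x) (val y).

Fact del_sym : symmetric del_rel.
Proof. by move=> x y; apply: adj_sym. Qed.

Fact del_irr : irreflexive del_rel.
Proof. by move=> x; apply: adj_irr. Qed.

Definition del : sgraph {x | x != z} := SGraph del_sym del_irr.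

Lemma iso_del (p : {x | x != z}) : (forall v, G z v = (v == val p)) ->
  iso G (add_pendant del p).
Proof.
(* [insub] sends the deleted vertex z to [None], the new vertex of [add_pendant]. *)
move=> zE; exists insub; split.
  exists (fun o => if o is Some x then val x else z) => [x|[x|]].
  - by case: insubP => [u _ <-|/negPn/eqP->].
  - by rewrite valK.
  - by rewrite insubF ?eqxx.
move=> x y; case: insubP => [u _ <-|/negPn/eqP->]; case: insubP => [v _ <-|/negPn/eqP->] //=.
all: by rewrite ?adj_irr // ?zE // adj_sym zE.
Qed.

Lemma card_del : #|{: {x | x != z}}| = #|V|.-1.
Proof. by rewrite card_sig -(cardC1 z); apply: eq_card => x; rewrite !inE. Qed.

Lemma del_C4_free : C4_free G -> C4_free del.
Proof.
move=> free [f [fI fE]]; apply: free; exists (val \o f); split; last exact: fE.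
exact: inj_comp val_inj fI.
Qed.

Lemma degree_del x : degree del x + G z (val x) = degree G (val x).
Proof.
rewrite !degreeE [RHS](bigID (pred1 z)) /= big_pred1_eq adj_sym addnC; congr (_ + _).
by rewrite -(big_sub (fun y => y != z) (fun y => G (val x) y : nat)).
Qed.

Lemma sum_degree_del :
  \sum_x degree del x + 2 * degree G z = \sum_x degree G x.
Proof.
have E : \sum_(x | x != z) degree G x = \sum_x degree del x + degree G z.
  rewrite (big_sub (fun y => y != z) (degree G)) (degreeE G z).
  rewrite [X in _ = _ + X](bigID (pred1 z)) /= big_pred1_eq adj_irr add0n.
  rewrite (big_sub (fun y => y != z) (fun y => G z y : nat)) -big_split /=.
  by apply: eq_bigr => x _; rewrite degree_del.
by rewrite [RHS](bigD1 z) //= E mul2n -addnn addnCA.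
Qed.

End Deletion.

(** * Windmills *)

Lemma card_windmill k m : #|windmill_vertex k m| = 1 + 2 * k + m.
Proof. by rewrite !(card_sum, card_prod, card_ord); lia. Qed.

Section Windmill.
Variables (V : finType) (G : sgraph V) (w : V) (k m : nat).
Hypotheses (free : C4_free G) (univ : forall v, G w v = (v != w)).
Hypotheses (sumG : \sum_u degree G u = 2 * (#|V| + k - 1)) (cardV : #|V| = 1 + 2 * k + m).

(** Since [w] is adjacent to all other vertices, [E] is a matching: two partners of v would be
    common neighbours of v and [w]. [T] collects the matched vertices, [R] the one of smaller rank
    in each pair, [I] the unmatched ones. *)
Let E v v' := [&& v != w, v' != w & G v v'].
Let mate v := odflt v [pick v' | E v v'].
Let T := [set v | [exists v', E v v']].
Let R := [set v in T | enum_rank v < enum_rank (mate v)].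
Let I := ~: (w |: T).

Let E_sym v v' : E v v' = E v' v.
Proof. by rewrite /E adj_sym andbCA. Qed.

Let E_uniq v a b : E v a -> E v b -> a = b.
Proof.
case/and3P => vw aw va /and3P[_ bw vb].
by apply: (C4_free_common free vw); rewrite ?univ.
Qed.

Let E_mate v v' : E v v' -> mate v = v'.
Proof. by rewrite /mate => Ev; case: pickP => [a|/(_ v')]; [move/E_uniq; apply | rewrite Ev]. Qed.

Let mateP v : v \in T -> E v (mate v).
Proof. by rewrite inE => /existsP[v' Ev]; rewrite (E_mate Ev). Qed.

Let mateT v : v \in T -> mate v \in T.
Proof. by move=> /mateP; rewrite E_sym inE => Ev; apply/existsP; exists v. Qed.

Let mateK v : v \in T -> mate (mate v) = v.
Proof. by move=> /mateP; rewrite E_sym => /E_mate. Qed.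

Let T_neq v : v \in T -> v != w.
Proof. by move=> /mateP/and3P[]. Qed.

Let mate_notR v : v \in R -> mate v \notin R.
Proof. by move=> /setIdP[vT lt]; apply/negP => /setIdP[_]; rewrite mateK // ltnNge (ltnW lt). Qed.

(** A vertex other than [w] has degree 2 if matched and 1 if not, so the degree sum determines the
    number of matched vertices. *)
Let cardT : #|T| = 2 * k.
Proof.
have degw : degree G w = #|V|.-1.
  by rewrite -(cardC1 w); apply: eq_card => v; rewrite !inE univ.
have deg v : v != w -> degree G v = 1 + (v \in T).
  move=> vw; rewrite degreeE (bigD1 w) //= adj_sym univ vw; congr addn.
  have [vT|vT] := boolP (v \in T).
    have /and3P[_ mw vm] := mateP vT.
    rewrite (bigD1 (mate v)) //= vm big1 // => x /andP[xw xm].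
    by apply/eqP; rewrite eqb0; apply: contra xm => vx; rewrite (@E_mate v x) // /E vw xw.
  rewrite big1 // => x xw; apply/eqP; rewrite eqb0; apply: contra vT => vx.
  by rewrite inE; apply/existsP; exists x; rewrite /E vw xw.
have : \sum_u degree G u = #|V|.-1 + (#|V|.-1 + #|T|).
  rewrite (bigD1 w) //= degw; congr addn; rewrite (eq_bigr _ deg) big_split /=; congr addn.
    by rewrite sum1_card cardC1.
  have wT : w \notin T by apply/negP => /T_neq; rewrite eqxx.
  rewrite -sum1_card [RHS]big_mkcond [RHS](bigD1 w) //= (negbTE wT) add0n.
  by apply: eq_bigr => v _; case: (v \in T).
by rewrite sumG cardV; lia.
Qed.

Let cardR : #|R| = k.
Proof.
have D : T :\: R = mate @: R.
  apply/setP => v; apply/setDP/imsetP => [[vT]|[u uR ->]]; last first.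
    by split; [apply: mateT; case/setIdP: uR | apply: mate_notR].
  rewrite inE vT -leqNgt => le; exists (mate v); last by rewrite mateK.
  rewrite inE mateT // mateK // ltn_neqAle le andbT; apply: contraTneq (mateP vT) => /val_inj/enum_rank_inj->.
  by rewrite /E adj_irr !andbF.
have RT : R \subset T by apply/subsetP => v; case/setIdP.
have := cardsD T R; rewrite D (setIidPr RT) card_in_imset; last first.
  by move=> u v /setIdP[uT _] /setIdP[vT _] /(congr1 mate); rewrite !mateK.
by have := subset_leq_card RT; rewrite cardT; lia.
Qed.

Let cardI : #|I| = m.
Proof.
have := cardsC (w |: T); rewrite -/I cardsU1 cardT cardV.
have -> : w \notin T by apply/negP => /T_neq; rewrite eqxx.
lia.
Qed.

Let repr (i : 'I_k) : V := enum_val (cast_ord (esym cardR) i).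
Let leaf (i : 'I_m) : V := enum_val (cast_ord (esym cardI) i).

Let tri (p : 'I_k * 'I_2) := if p.2 == ord0 then repr p.1 else mate (repr p.1).

Let place (x : windmill_vertex k m) : V :=
  match x with
  | inl _ => w
  | inr (inl p) => tri p
  | inr (inr i) => leaf i
  end.

Let reprR i : repr i \in R. Proof. exact: enum_valP. Qed.
Let reprT i : repr i \in T. Proof. by have /setIdP[] := reprR i. Qed.
Let repr_inj : injective repr. Proof. by move=> i j /enum_val_inj/cast_ord_inj. Qed.
Let leafI i : leaf i \in I. Proof. exact: enum_valP. Qed.
Let leaf_inj : injective leaf. Proof. by move=> i j /enum_val_inj/cast_ord_inj. Qed.

Let triT p : tri p \in T.
Proof. by case: p => i j; rewrite /tri /=; case: ifP => _; rewrite ?mateT. Qed.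

Let tri_inj : injective tri.
Proof.
case=> i [[|[|//]] hj] [i' [[|[|//]] hj']]; rewrite /tri /= => e.
- by rewrite (repr_inj e) (bool_irrelevance hj hj').
- by have := mate_notR (reprR i'); rewrite -e reprR.
- by have := mate_notR (reprR i); rewrite e reprR.
- by move/(congr1 mate): e; rewrite !mateK // => /repr_inj->; rewrite (bool_irrelevance hj hj').
Qed.

Let flip (p : 'I_k * 'I_2) : 'I_k * 'I_2 := (p.1, rev_ord p.2).

Let mate_tri p : mate (tri p) = tri (flip p).
Proof. by case: p => i [[|[|//]] hj]; rewrite /tri /= ?mateK. Qed.

Let flipE p q : (q == flip p) = windmill k m (inr (inl p)) (inr (inl q)).
Proof.
case: p q => i [[|[|//]] hj] [i' [[|[|//]] hj']];
by rewrite /= /copies_rel /= /complete_rel xpair_eqE -!val_eqE /= ?andbF ?andbT // eq_sym.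
Qed.

(** The image of the center is recorded so that a pendant vertex attached away from [w] can be
    recognised later as attached away from the center. *)
Lemma windmill_placement : exists g : windmill_vertex k m -> V,
  [/\ bijective g, forall x y, G (g x) (g y) = windmill k m x y
    & g (windmill_center k m) = w].
Proof.
have leaf_notT i : leaf i \notin T /\ leaf i != w.
  by have := leafI i; rewrite in_setC in_setU1 negb_or => /andP[].
have Gtri p v : v != w -> G (tri p) v = (v == tri (flip p)).
  move=> vw; have /mateP Ep := triT p; rewrite -mate_tri.
  apply/idP/eqP => [pv|->]; last by case/and3P: Ep.
  by rewrite (@E_mate (tri p) v) // /E vw T_neq.
have Gleaf i v : v != w -> G (leaf i) v = false.
  move=> vw; have [lT lw] := leaf_notT i; apply: contraNF lT => lv.
  by rewrite inE; apply/existsP; exists v; rewrite /E lw vw.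
exists place; split=> //.
  apply: inj_card_bij; last by rewrite card_windmill cardV.
  case=> [x|[p|i]] [y|[q|j]] //=.
  - by rewrite (ord1 x) (ord1 y).
  - by move=> e; have := T_neq (triT q); rewrite -e eqxx.
  - by move=> e; have [_] := leaf_notT j; rewrite -e eqxx.
  - by move=> e; have := T_neq (triT p); rewrite e eqxx.
  - by move/tri_inj->.
  - by move=> e; have [] := leaf_notT j; rewrite -e triT.
  - by move=> e; have [_] := leaf_notT i; rewrite e eqxx.
  - by move=> e; have [] := leaf_notT i; rewrite e triT.
  - by move/leaf_inj->.
case=> [x|[p|i]] [y|[q|j]].
- by rewrite /= adj_irr (ord1 x) (ord1 y) /complete_rel eqxx.
- by rewrite /= univ (T_neq (triT q)).
- by rewrite /= univ; have [_] := leaf_notT j.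
- by rewrite /= adj_sym univ (T_neq (triT p)).
- by rewrite -flipE -(inj_eq tri_inj) -Gtri ?T_neq.
- by rewrite [LHS](Gtri p) ?(leaf_notT j).2 //=; apply/eqP => e; have [] := leaf_notT j; rewrite e triT.
- by rewrite /= adj_sym univ; have [_] := leaf_notT i.
- by rewrite [LHS]Gleaf ?(T_neq (triT q)).
- by rewrite [LHS]Gleaf ?(leaf_notT j).2.
Qed.

End Windmill.

(** Common shape of [G2] and [G5], with k + 1 triangles; [path_pendant] is that of [G3] and [G6],
    with k triangles. *)
Definition triangle_pendant (k m : nat) :=
  add_pendant (windmill k.+1 m) (windmill_triangle_vertex k m).

Definition path_pendant (k m : nat) :=
  add_pendant (add_pendant (windmill k m) (windmill_center k m)) None.

(** Transposing two triangles, and the two ends within every triangle, is an automorphism of the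
    windmill that carries p to the chosen vertex. *)
Lemma iso_triangle_pendant k m p :
  iso (add_pendant (windmill k.+1 m) (inr (inl p))) (triangle_pendant k m).
Proof.
pose f (x : windmill_vertex k.+1 m) : windmill_vertex k.+1 m :=
  if x is inr (inl q) then inr (inl (tperm p.1 ord0 q.1, tperm p.2 ord0 q.2)) else x.
have fK : cancel f f by case=> [x|[[a b]|x]] //=; rewrite !tpermK.
have -> : triangle_pendant k m = add_pendant (windmill k.+1 m) (f (inr (inl p))).
  by rewrite /f /triangle_pendant /windmill_triangle_vertex !tpermL.
apply: iso_add_pendant; first by exists f.
case=> [x|[[a b]|x]] [y|[[c d]|y]] //=.
by rewrite /copies_rel /= /complete_rel !(inj_eq perm_inj).
Qed.

(** The leaf i becomes the middle vertex of the pendant path, and [unlift] renumbers the other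
    leaves. *)
Lemma iso_path_pendant k m i :
  iso (add_pendant (windmill k m.+1) (inr (inr i))) (path_pendant k m).
Proof.
pose f (x : windmill_vertex k m.+1) : option (windmill_vertex k m) :=
  match x with
  | inl x => Some (inl x)
  | inr (inl p) => Some (inr (inl p))
  | inr (inr a) => omap (fun b => inr (inr b)) (unlift i a)
  end.
have -> : path_pendant k m =
    add_pendant (add_pendant (windmill k m) (windmill_center k m)) (f (inr (inr i))).
  by rewrite /f unlift_none.
apply: iso_add_pendant.
  apply: inj_card_bij; last by rewrite card_option !card_windmill addnS.
  case=> [x|[p|a]] [y|[q|b]] //=; try by move=> [->].
  - by case: unliftP.
  - by case: unliftP.
  - by case: unliftP.
  - by case: unliftP.
  - by case: unliftP => [a' ->|->]; case: unliftP => [b' ->|->] //= [->].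
case=> [x|[p|a]] [y|[q|b]] //=.
- by case: unliftP => //= _; rewrite (ord1 x).
- by case: unliftP.
- by case: unliftP => //= _; rewrite (ord1 y).
- by case: unliftP.
- by case: unliftP => [a' _|_]; case: unliftP => [b' _|_].
Qed.

(** * Graphs with a vertex of degree at least n - 2 *)

Section Classification.
Variables (V : finType) (G : sgraph V) (k : nat).
Hypotheses (free : C4_free G) (sumG : \sum_u degree G u = 2 * (#|V| + k - 1)).

Lemma iso_windmill w : 2 * k < #|V| -> (#|V|.-1 <= degree G w) ->
  iso G (Gnk #|V| k).
Proof.
move=> ltk degw.
have univ v : G w v = (v != w).
  have E : [set v | G w v] = [set~ w].
    apply/eqP; rewrite eqEcard cardsC1 degw andbT.
    by apply/subsetP => x; rewrite !inE eq_sym => /adj_neq.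
  by have := in_set (G w) v; rewrite E !inE.
have [|g [gB gE _]] := windmill_placement free univ sumG (m := #|V| - 2 * k - 1); first lia.
by apply: iso_sym; exists g.
Qed.

(** All neighbours of the one vertex z missed by w are neighbours of w, so C4-freeness leaves z a
    single neighbour. Deleting z lowers the degree sum by 2 and the order by 1, which preserves k,
    and w is universal in the rest. *)
Lemma iso_pendant_windmill w : 2 * k + 2 <= #|V| -> (forall u, 0 < degree G u) ->
  degree G w = #|V| - 2 ->
  exists2 q, q != windmill_center k (#|V| - 2 * k - 2) &
    iso G (add_pendant (windmill k (#|V| - 2 * k - 2)) q).
Proof.
move=> ltk deg0 degw.
have /cards1P[z zE] : #|[set~ w] :\: [set v | G w v]| == 1.
  rewrite cardsD (setIidPr _); last by apply/subsetP => v; rewrite !inE eq_sym => /adj_neq.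
  by rewrite cardsC1 -/(degree G w) degw; apply/eqP; lia.
have nonadj v : (v != w) && ~~ G w v = (v == z).
  by rewrite -(in_set1 v z) -zE !inE andbC.
have /andP[zw wz] : (z != w) && ~~ G w z by rewrite nonadj.
have [p] : exists p, p \in [set v | G z v] by apply/card_gt0P; apply: deg0.
rewrite inE => zp.
have adjw v : G z v -> G w v.
  move=> zv; have := nonadj v; rewrite [v == z]eq_sym (negbTE (adj_neq zv)).
  have -> : v != w by apply: contraNneq wz => <-; rewrite adj_sym.
  by move/negbFE.
have zadj v : G z v = (v == p).
  apply/idP/eqP => [zv|-> //].
  by apply: (C4_free_common free zw) => //; apply: adjw.
have pz : p != z by rewrite eq_sym (adj_neq zp).
have zw' : w != z by rewrite eq_sym.
have univ (v : {x | x != z}) : del G z (exist _ w zw') v = (v != exist _ w zw').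
  rewrite -val_eqE /= /del_rel /=; have := nonadj (val v).
  rewrite (negbTE (valP v)); have [e|vw] := eqVneq (val v) w; first by rewrite -[sval v]/(val v) e adj_irr.
  by move/negbFE.
have degz : degree G z = 1.
  by rewrite /degree (_ : [set v | G z v] = [set p]) ?cards1 //; apply/setP => v; rewrite !inE zadj.
have cardD := card_del z.
have [||g [gB gE gc]] := windmill_placement (del_C4_free (z := z) free) univ (k := k) (m := #|V| - 2 * k - 2).
- have := sum_degree_del G z; rewrite sumG degz cardD; lia.
- rewrite cardD; lia.
have [h hK gK] := gB.
exists (h (exist _ p pz)).
  rewrite -(inj_eq (can_inj hK)) gK gc -val_eqE /=.
  by rewrite eq_sym (adj_neq (adjw _ zp)).
apply: iso_trans (iso_del (p := exist _ p pz) zadj) _.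
apply: iso_sym; rewrite -{2}(gK (exist _ p pz)).
exact: iso_add_pendant.
Qed.

End Classification.

Lemma iso_triangle_or_path_pendant (V : finType) (G : sgraph V) k w :
  C4_free G -> \sum_u degree G u = 2 * (#|V| + k.+1 - 1) ->
  2 * k.+1 + 2 < #|V| -> (forall u, 0 < degree G u) -> degree G w = #|V| - 2 ->
  iso G (triangle_pendant k (#|V| - 2 * k.+1 - 2)) \/
  iso G (path_pendant k.+1 (#|V| - 2 * k.+1 - 3)).
Proof.
move=> free sumG ltk deg0 degw.
have [q] := iso_pendant_windmill free sumG (ltnW ltk) deg0 degw.
case: q => [x|[p|i]].
- by rewrite (ord1 x) eqxx.
- by move=> _ iG; left; exact: (iso_trans iG (iso_triangle_pendant _ p)).
move: i; have -> : #|V| - 2 * k.+1 - 2 = (#|V| - 2 * k.+1 - 3).+1 by lia.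
by move=> i _ iG; right; exact: (iso_trans iG (iso_path_pendant _ i)).
Qed.

(** * Degree counts around a vertex *)

Section NeighbourDegrees.
Variables (V : finType) (G : sgraph V).

Definition ndeg u := \sum_(v | G u v) degree G v.
Definition far u : {set V} := [set w | (w != u) && ~~ G u w].

Lemma card_far u : degree G u + #|far u| = #|V|.-1.
Proof.
rewrite -(cardsC1 u) -(cardsID [set w | G u w] [set~ u]); congr addn; apply: eq_card => w.
  rewrite !inE andb_idl // => /adj_neq; by rewrite eq_sym.
by rewrite !inE andbC.
Qed.

Lemma sum_degree_far u :
  \sum_v degree G v = degree G u + ndeg u + \sum_(w in far u) degree G w.
Proof.
rewrite (bigD1 u) //= -addnA; congr addn.
rewrite (bigID (G u)) /=; congr addn; apply: eq_bigl => w; rewrite ?inE //.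
by rewrite andb_idl // => /adj_neq; rewrite eq_sym.
Qed.

Lemma ndegE u : ndeg u = \sum_w \sum_(v | G u v) (G v w : nat).
Proof. by rewrite exchange_big; apply: eq_bigr => v _; rewrite degreeE. Qed.

(** [ndeg] counts the walks of length 2 from u; those that return to u number [degree G u]. *)
Lemma ndeg_split u : ndeg u = degree G u + \sum_(w | w != u) \sum_(v | G u v) (G v w : nat).
Proof.
rewrite ndegE (bigD1 u) //=; congr addn; rewrite degreeE [LHS]big_mkcond.
by apply: eq_bigr => v _; rewrite [G v u]adj_sym; case: (G u v).
Qed.

Lemma codegree_le1 u w : C4_free G -> w != u -> \sum_(v | G u v) (G v w : nat) <= 1.
Proof.
move=> free wu; have [/existsP[a /andP[ua aw]]|none] := boolP [exists a, G u a && G a w].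
  rewrite (bigD1 a) //= aw big1 // => b /andP[ub ba].
  apply/eqP; rewrite eqb0; apply: contra ba => bw.
  by apply/eqP; apply: (C4_free_common free wu) => //; rewrite adj_sym.
rewrite big1 // => v uv; apply/eqP; rewrite eqb0; apply: contra none => vw.
by apply/existsP; exists v; rewrite uv.
Qed.

Lemma ndeg_le_card u : C4_free G -> ndeg u <= degree G u + #|V|.-1.
Proof.
move=> free; rewrite ndeg_split leq_add2l -(cardC1 u) -sum1_card.
by apply: leq_sum => w wu; apply: codegree_le1.
Qed.

(** Without a triangle at u, a walk of length 2 from u that does not return ends in [far], and
    C4-freeness allows one walk per end. *)
Lemma ndeg_no_triangle u : C4_free G -> (forall a b, G u a -> G u b -> ~~ G a b) ->
  ndeg u <= degree G u + #|far u|.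
Proof.
move=> free notri; rewrite ndeg_split leq_add2l -sum1_card.
rewrite [X in _ <= X]big_mkcond [X in X <= _]big_mkcond; apply: leq_sum => w _; rewrite inE.
case: eqVneq => //= wu; have [uw|_] := boolP (G u w); last exact: codegree_le1.
by rewrite big1 // => v uv; apply/eqP; rewrite eqb0 notri.
Qed.

Lemma card_far_le u : (forall v, 0 < degree G v) -> #|far u| <= \sum_(w in far u) degree G w.
Proof. by move=> deg0; rewrite -sum1_card; apply: leq_sum. Qed.

Lemma degree_far u w : (forall v, 0 < degree G v) ->
  \sum_(v in far u) degree G v = #|far u| -> w \in far u -> degree G w = 1.
Proof.
move=> deg0 E wu; have : \sum_(v in far u | v != w) 1 <= \sum_(v in far u | v != w) degree G v.
  by apply: leq_sum.
have := deg0 w; move: E; rewrite -sum1_card (bigD1 w) //= [in RHS](bigD1 w) //=.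
by set s := \sum_(v in _ | _) _; set s' := \sum_(v in _ | _) _; lia.
Qed.

(** For a triangle u a b these are the neighbours of a outside it. C4-freeness puts them in [far u]
    and makes them disjoint from those of b. *)
Definition touch u a b : {set V} := [set w | [&& G a w, w != u & w != b]].

Lemma sum_touch (T : nmodType) (F : V -> T) u a b : G a u -> G a b -> u != b ->
  (\sum_(w | G a w) F w = F u + (F b + \sum_(w in touch u a b) F w))%R.
Proof.
move=> au ab ub; rewrite (bigD1 u) //= (bigD1 b) /= ?ab 1?eq_sym //.
by congr (_ + (_ + _))%R; apply: eq_bigl => w; rewrite inE andbA.
Qed.

Lemma degree_touch u a b : G a u -> G a b -> u != b -> degree G a = 2 + #|touch u a b|.
Proof.
move=> au ab ub; rewrite -[2]/(1 + 1) -addnA -sum1_card /degree -sum1_card.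
rewrite (eq_bigl (G a)) => [|w]; last by rewrite inE.
exact: (sum_touch (fun=> 1%N)).
Qed.

Lemma touch_far u a b : C4_free G -> G u a -> G u b -> G a b -> touch u a b \subset far u.
Proof.
move=> free ua ub ab; apply/subsetP => w; rewrite !inE => /and3P[aw wu wb].
rewrite wu; apply: contra wb => uw; apply/eqP.
exact: (C4_free_common free (adj_neq ua)).
Qed.

Lemma card_touch u a b : C4_free G -> G u a -> G u b -> G a b ->
  #|touch u a b| + #|touch u b a| <= #|far u|.
Proof.
move=> free ua ub ab; have ba : G b a by rewrite adj_sym.
have <- : #|touch u a b :|: touch u b a| = #|touch u a b| + #|touch u b a|.
  rewrite cardsU (_ : _ :&: _ = set0) ?cards0 ?subn0 //; apply/setP => w; rewrite !inE.
  apply/negP => /andP[/and3P[aw wu _] /and3P[bw _ _]].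
  have := adj_neq ab; suff -> : a = b by rewrite eqxx.
  by apply: (C4_free_common free wu); rewrite // adj_sym.
by rewrite subset_leq_card // subUset !touch_far.
Qed.

Lemma ndeg_le_max u D : (forall v, degree G v <= D) -> ndeg u <= degree G u * D.
Proof.
move=> le; rewrite /degree -sum_nat_const /ndeg.
rewrite (eq_bigl (G u)) => [|w]; last by rewrite inE.
by apply: leq_sum.
Qed.

End NeighbourDegrees.

(* The only case in which the bound d + ndeg / d of an eigenvalue exceeds n - 1. *)
Lemma ndeg_critical (V : finType) (G : sgraph V) k u :
  C4_free G -> \sum_v degree G v = 2 * (#|V| + k - 1) -> (forall v, 0 < degree G v) ->
  (forall v, degree G v <= #|V| - 3) -> 6 <= #|V| -> 2 * k + 4 <= #|V| ->
  #|V|.-1 * degree G u < degree G u ^ 2 + ndeg G u ->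
  [/\ 3 <= degree G u, #|V| = degree G u + 3, ndeg G u = 2 * degree G u + 1 &
      \sum_(w in far G u) degree G w = #|far G u|].
Proof.
move=> free sumG deg0 degD n6 nk lt.
have := ndeg_le_card u free; have := ndeg_le_max u degD; have := card_far_le u deg0.
have := sum_degree_far G u; rewrite sumG; have := card_far G u; have := degD u; have := deg0 u.
move: lt; move: (degree G u) (ndeg G u) (\sum_(w in far G u) _) #|far G u| #|V| n6 nk {sumG degD deg0}.
move=> d S f c n n6 nk lt d0 dn card sum fc Sd Sn.
(* As S <= d (n - 3), the bound d + S / d is at most d + n - 3, which is at most n - 1 for d <=
   2. *)
have d3 : 3 <= d by nia.
have dE : d = n - 3.
  apply/eqP; rewrite eqn_leq dn leqNgt; apply/negP => dlt.
  (* With n = d + 4 + q, the bound S <= d + n - 1 would leave d (1 + q) < 3 + q, impossible for d >=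
     3. *)
  have [p dp] : exists p, d = p + 3 by exists (d - 3); lia.
  have [q nq] : exists q, n = d + 4 + q by exists (n - 4 - d); lia.
  subst n d; nia.
have nE : n = d + 3 by lia.
(* Now f = 2, and 2 k + 4 <= n gives S + c <= 2 d + 3 with c >= f, so S > 2 d fixes both S and c. *)
subst n; have : S > 2 * d by nia.
by move=> S2; split; lia.
Qed.

Local Open Scope ring_scope.

(** * Laplacian eigenfunctions *)

(** Applied to the characteristic polynomial, this shows that the supremum defining [mu] is
    attained. *)
Lemma max_root (R : realFieldType) (p : {poly R}) (a : R) :
  p != 0 -> root p a ->
  exists2 b, root p b & forall c, root p c -> c <= b.
Proof.
have [n] := ubnP (size p); elim: n p a => // n IHn p a ltpn p0 pa.
have [q pq] := factor_theorem p a pa.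
have q0 : q != 0 by apply: contra_neq p0 => q0; rewrite pq q0 mul0r.
have rootE c : root p c = root q c || (c == a) by rewrite pq rootM root_XsubC.
have [[c qc]|noroot] := boolp.EM (exists c, root q c).
  have ltqn : (size q < n)%N.
    by move: ltpn; rewrite pq size_mul ?polyXsubC_eq0 // size_XsubC addn2 ltnS.
  have [b qb maxb] := IHn q c ltqn q0 qc.
  exists (Num.max a b) => [|d]; first by rewrite rootE maxEle; case: ifP; rewrite ?qb ?eqxx ?orbT.
  by rewrite rootE le_max => /orP[/maxb->|/eqP->]; rewrite ?lexx ?orbT.
exists a => // c; rewrite rootE => /orP[qc|/eqP-> //].
by case: noroot; exists c.
Qed.

Section Spectrum.
Variables (R : realType) (V : finType) (G : sgraph V).

(** The Laplacian acting on functions on the vertices, free of the enumeration that indexes the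
    matrix. *)
Definition lap (x : V -> R) (u : V) : R := \sum_(v | G u v) (x u - x v).

Definition eigenfun (a : R) (x : V -> R) : Prop :=
  (exists u, x u != 0) /\ forall u, lap x u = a * x u.

Lemma eigenfunP a :
  eigenvalue (laplacian_mx R G) a <-> exists x, eigenfun a x.
Proof.
have mulE (x : V -> R) j :
    ((\row_i x (enum_val i)) *m laplacian_mx R G) 0 j = lap x (enum_val j).
  rewrite /laplacian_mx mulmxBr mxE mul_mx_diag !mxE /lap sumrB big_const.
  rewrite iter_addr addr0 /degree -(cardsE (fun v => G (enum_val j) v)).
  rewrite mulr_natr; congr (_ - _).
  transitivity (\sum_(v in V) (G (enum_val j) v)%:R * x v); last first.
    by rewrite [RHS]big_mkcond; apply: eq_bigr => v _; case: (G _ v); rewrite ?mul1r ?mul0r.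
  rewrite (big_enum_val (A := V)) /=; apply: eq_bigr => i _.
  by rewrite !mxE adj_sym mulrC.
split=> [/eigenvalueP[v vL v0]|[x [[u xu] xL]]].
  pose x u := v 0 (enum_rank u).
  have vE : v = \row_i x (enum_val i) by apply/rowP => i; rewrite !mxE /x enum_valK.
  exists x; split=> [|u].
    by have /rV0Pn[i vi] := v0; exists (enum_val i); rewrite /x enum_valK.
  by rewrite -[u]enum_rankK -mulE -vE vL mxE {1}vE mxE.
apply/eigenvalueP; exists (\row_i x (enum_val i)).
  by apply/rowP => j; rewrite mulE xL !mxE.
by apply/rV0Pn; exists (enum_rank u); rewrite mxE enum_rankK.
Qed.

Lemma eigenfun_le_mu_aux (v0 : V) :
  (exists x, eigenfun (mu R G) x) /\ forall a x, eigenfun a x -> a <= mu R G.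
Proof.
(* Constant functions have eigenvalue 0, which supplies a first root. *)
have ev0 : root (char_poly (laplacian_mx R G)) 0.
  rewrite -eigenvalue_root_char; apply/eigenfunP; exists (fun=> 1); split.
    by exists v0; rewrite oner_eq0.
  by move=> u; rewrite /lap big1 ?mul0r // => v _; rewrite subrr.
have [b rootb maxb] := max_root (monic_neq0 (char_poly_monic _)) ev0.
have muE : mu R G = b.
  rewrite /mu; set E := (X in sup X).
  have Eb : E b by rewrite /E /= eigenvalue_root_char.
  have ubE : classical_sets.ubound E b by move=> c; rewrite /E /= eigenvalue_root_char; apply: maxb.
  apply/eqP; rewrite eq_le ge_sup ?ub_le_sup //; by exists b.
rewrite muE; split; first by apply/eigenfunP; rewrite eigenvalue_root_char.
by move=> a x ex; apply: maxb; rewrite -eigenvalue_root_char; apply/eigenfunP; exists x.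
Qed.

Lemma mu_eigenfun (v0 : V) : exists x, eigenfun (mu R G) x.
Proof. by have [] := eigenfun_le_mu_aux v0. Qed.

Lemma eigenfun_le_mu a x : eigenfun a x -> a <= mu R G.
Proof. by move=> ex; have [[u _] _] := ex; have [_] := eigenfun_le_mu_aux u; apply; apply: ex. Qed.

Lemma sum_lap (x : V -> R) : \sum_u lap x u = 0.
Proof.
rewrite /lap; apply/eqP.
have E : \sum_u \sum_(v | G u v) (x u - x v) = - \sum_u \sum_(v | G u v) (x u - x v).
  rewrite [LHS](exchange_big_dep predT) //= -sumrN; apply: eq_bigr => u _.
  by rewrite -sumrN; apply: eq_big => [v|v _]; rewrite ?opprB // adj_sym.
by move: E; set s := \sum_u _; lra.
Qed.

Lemma sum_mul_lap (x : V -> R) :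
  \sum_u x u * lap x u = 2^-1 * \sum_u \sum_(v | G u v) (x u - x v) ^+ 2.
Proof.
suff: \sum_u \sum_(v | G u v) (x u - x v) ^+ 2 = \sum_u x u * lap x u + \sum_u x u * lap x u by lra.
have E : \sum_u x u * lap x u = \sum_u \sum_(v | G u v) x v * (x v - x u).
  rewrite [RHS](exchange_big_dep predT) //=; apply: eq_bigr => u _.
  by rewrite /lap mulr_sumr; apply: eq_bigl => v; rewrite adj_sym.
rewrite {1}E -big_split /=; apply: eq_bigr => u _.
rewrite /lap mulr_sumr -big_split /=; apply: eq_bigr => v _; ring.
Qed.

Lemma eigenfun_sum0 (a : R) x : a != 0 -> eigenfun a x -> \sum_u x u = 0.
Proof.
move=> a0 [_ xL]; apply/(mulfI a0); rewrite mulr0 mulr_sumr.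
by rewrite -[RHS](sum_lap x); apply: eq_bigr => u _; rewrite xL.
Qed.

(* The quadratic form of a graph and of its complement add up to that of the
   complete graph, which is n times the squared norm on functions of sum 0. *)
Lemma complement_form (a : R) x : a != 0 -> eigenfun a x ->
  (#|V|%:R - a) * \sum_u x u ^+ 2 =
  2^-1 * \sum_u \sum_(v | ~~ G u v) (x u - x v) ^+ 2.
Proof.
move=> a0 ex; have s0 := eigenfun_sum0 a0 ex; have [_ xL] := ex.
have E1 : a * \sum_u x u ^+ 2 = 2^-1 * \sum_u \sum_(v | G u v) (x u - x v) ^+ 2.
  by rewrite -sum_mul_lap mulr_sumr; apply: eq_bigr => u _; rewrite xL; ring.
have E2 : \sum_u \sum_v (x u - x v) ^+ 2 = 2 * (#|V|%:R * \sum_u x u ^+ 2).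
  transitivity (\sum_u (#|V|%:R * x u ^+ 2 + \sum_v x v ^+ 2)).
    apply: eq_bigr => u _.
    transitivity (\sum_v (x u ^+ 2 + (x v ^+ 2 - 2 * x u * x v))); first by apply: eq_bigr => v _; ring.
    have -> : \sum_v x v ^+ 2 = \sum_v x v ^+ 2 - \sum_v 2 * x u * x v by rewrite -[X in _ - X]mulr_sumr s0 mulr0 subr0.
    rewrite big_split sumrB /=; congr (_ + _).
    by rewrite big_const iter_addr addr0 mulr_natl.
  by rewrite big_split /= -mulr_sumr big_const iter_addr addr0 -mulr_natl; ring.
have E3 : \sum_u \sum_v (x u - x v) ^+ 2 = \sum_u \sum_(v | G u v) (x u - x v) ^+ 2 +
  \sum_u \sum_(v | ~~ G u v) (x u - x v) ^+ 2.
  by rewrite -big_split /=; apply: eq_bigr => u _; rewrite (bigID (G u)).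
rewrite mulrBl E1; move: E2; rewrite E3; lra.
Qed.

Lemma sum_sqr_gt0 (x : V -> R) u : x u != 0 -> 0 < \sum_u x u ^+ 2.
Proof.
move=> xu; rewrite (bigD1 u) //= ltr_pwDl ?exprn_even_gt0 //.
by apply: sumr_ge0 => v _; apply: sqr_ge0.
Qed.

Lemma eigenfun_le_card a x : eigenfun a x -> a <= #|V|%:R.
Proof.
have [->|a0] := eqVneq a 0 => // ex.
have := complement_form a0 ex; have [[u xu] _] := ex.
have := sum_sqr_gt0 xu; set s := \sum_u _ => s0 E.
rewrite -subr_ge0 -(pmulr_lge0 _ s0) E mulr_ge0 ?invr_ge0 //.
by apply: sumr_ge0 => v _; apply: sumr_ge0 => w _; apply: sqr_ge0.
Qed.

(** For the eigenvalue n the left side of [complement_form] vanishes, hence so does every square on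
    the right. *)
Lemma eigenfun_card_nonadj x : eigenfun #|V|%:R x ->
  forall u v, ~~ G u v -> x u = x v.
Proof.
move=> ex; have [[w xw] _] := ex.
have n0 : #|V|%:R != 0 :> R by rewrite pnatr_eq0 -lt0n; apply/card_gt0P; exists w.
have := complement_form n0 ex; rewrite subrr mul0r => /esym/eqP.
rewrite mulf_eq0 invr_eq0 pnatr_eq0 /= psumr_eq0 => [/allP E u v uv|v _]; last first.
  by apply: sumr_ge0 => ? _; apply: sqr_ge0.
have := E u (mem_index_enum _); rewrite /= psumr_eq0 => [/allP/(_ v (mem_index_enum _))|? _]; last exact: sqr_ge0.
by rewrite uv /= sqrf_eq0 subr_eq0 => /eqP.
Qed.

End Spectrum.

Lemma iso_mu (R : realType) (V W : finType) (G : sgraph V) (H : sgraph W) :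
  iso G H -> mu R G = mu R H.
Proof.
case=> f [[g fK gK] fH]; rewrite /mu; congr sup; apply/classical_sets.seteqP; split=> a /=.
  move/eigenfunP => [x [[u xu] xL]]; apply/eigenfunP; exists (x \o g); split.
    by exists (f u); rewrite /= fK.
  move=> w; rewrite /= -xL /lap (reindex f) /=; last by exists g => ? _; rewrite ?fK ?gK.
  by apply: eq_big => [v|v _]; rewrite -?fH ?gK ?fK.
move/eigenfunP => [x [[u xu] xL]]; apply/eigenfunP; exists (x \o f); split.
  by exists (g u); rewrite /= gK.
move=> w; rewrite /= -xL /lap [RHS](reindex f) /=; last by exists g => ? _; rewrite ?fK ?gK.
by apply: eq_bigl => v; rewrite fH.
Qed.

(** * The eigenvalue bound for maximum degree at most n - 3 *)

Section UpperBound.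
Variables (R : realType) (V : finType) (G : sgraph V).

Lemma eigenfun_normalize a (x : V -> R) : (forall v, (0 < degree G v)%N) -> eigenfun G a x ->
  exists y u, [/\ eigenfun G a y, y u = (degree G u)%:R & forall v, `|y v| <= (degree G v)%:R].
Proof.
move=> deg0 [[u0 xu0] xL].
have dgt0 v : 0 < (degree G v)%:R :> R by rewrite ltr0n.
have [u _ maxu] := @arg_maxP _ _ _ u0 xpredT (fun v => `|x v| / (degree G v)%:R) isT.
have {}maxu v : `|x v| / (degree G v)%:R <= `|x u| / (degree G u)%:R by apply: maxu.
have xu : x u != 0.
  apply: contra_neq xu0 => xu; have := maxu u0.
  by rewrite xu normr0 mul0r pmulr_lle0 ?invr_gt0 // normr_le0 => /eqP.
(* Rescaling by this factor makes the maximal ratio |x u| / degree u equal to 1 and the value at u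
   positive. *)
exists (fun v => x v * ((degree G u)%:R / x u)), u; split.
- split; first by exists u; rewrite mulrCA divff // mulr1 gt_eqF.
  move=> v; rewrite mulrA -xL /lap mulr_suml; apply: eq_bigr => w _; ring.
- by rewrite mulrCA divff // mulr1.
- move=> v; have := maxu v; rewrite ler_pdivrMr // => le.
  rewrite normrM normf_div normr_nat mulrA ler_pdivrMr ?normr_gt0 //.
  by rewrite [leRHS]mulrC -ler_pdivlMr // mulrAC.
Qed.

(** p and q stand for the eigenfunction at the two vertices of a triangle other than u, i and j for
    their numbers of neighbours outside it. Adding the two inequalities bounds (a - 1) (-(p + q))
    from above, and this is too small in each of the six cases for i and j. *)
Lemma critical_triangle_absurd (i j : nat) (d a p q : R) : (i + j <= 2)%N -> 3 <= d -> d + 2 < a ->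
  (p - d) + (p - q) - i%:R * (3 + i%:R) <= a * p ->
  (q - d) + (q - p) - j%:R * (3 + j%:R) <= a * q ->
  3 + i%:R + j%:R < - (p + q) -> False.
Proof.
move=> ij d3 da ep eq_ tl.
have big : (d + 1) * (3 + i%:R + j%:R) <= (a - 1) * - (p + q).
  by apply: ler_pM; rewrite ?addr_ge0 ?ler0n //; lra.
have {tl} : (d + 1) * (3 + i%:R + j%:R) <= 2 * d + i%:R * (3 + i%:R) + j%:R * (3 + j%:R) by lra.
by move: ij {big ep eq_}; case: i => [|[|[|i]]]; case: j => [|[|[|j]]] // _; lra.
Qed.

(* At a vertex u maximising |x u| / degree u the eigenvalue is at most degree u + ndeg u / degree u.
   In the critical case the excess is absorbed by a triangle at u: the two eigenvalue equations of its other vertices a and b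
   add up to one in which x a - x b cancels, so that x a + x b is much smaller than degree a + degree b. *)
Lemma eigenvalue_le_max_degree k a (x : V -> R) :
  C4_free G -> (\sum_v degree G v = 2 * (#|V| + k - 1))%N -> (forall v, (0 < degree G v)%N) ->
  (forall v, (degree G v <= #|V| - 3)%N) -> (6 <= #|V|)%N -> (2 * k + 4 <= #|V|)%N ->
  eigenfun G a x -> a <= #|V|.-1%:R.
Proof.
move=> free sumG deg0 degD n6 nk /(eigenfun_normalize deg0)[{}x [u [[_ xL] xu xle]]].
rewrite leNgt; apply/negP => alt.
set d : R := (degree G u)%:R in xu.
have d0 : 0 < d by rewrite ltr0n.
have xlo v : - x v <= (degree G v)%:R by rewrite (le_trans _ (xle v)) // -normrN ler_norm.
have degE v : \sum_(w | G v w) (1 : R) = (degree G v)%:R.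
  by rewrite degreeE natr_sum big_mkcond; apply: eq_bigr => w _; case: (G v w).
have sumu : a * d = d ^+ 2 - \sum_(v | G u v) x v.
  rewrite -xu -xL /lap sumrB; congr (_ - _).
  by rewrite xu -(eq_bigr _ (fun v _ => mulr1 d)) -mulr_sumr degE.
have ndegR : \sum_(v | G u v) (degree G v)%:R = (ndeg G u)%:R :> R by rewrite natr_sum.
have crit : (#|V|.-1 * degree G u < degree G u ^ 2 + ndeg G u)%N.
  rewrite -(ltr_nat R) natrM natrD natrX -/d.
  apply: (lt_le_trans (y := a * d)); first by rewrite ltr_pM2r.
  by rewrite sumu lerD2l -ndegR -sumrN; apply: ler_sum.
have [d3 nE SE farE] := ndeg_critical free sumG deg0 degD n6 nk crit.
have d3R : 3 <= d by rewrite ler_nat.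
have cfar := card_far G u.
have [/existsP[p /existsP[q /and3P[up uq pq]]]|none] :=
    boolP [exists p, exists q, [&& G u p, G u q & G p q]]; last first.
  (* Here [far G u] has two elements, so this would give 2 d + 1 <= d + 2 although d >= 3. *)
  suff : (ndeg G u <= degree G u + #|far G u|)%N by lia.
  apply: ndeg_no_triangle => // p q up uq; apply: contra none => pq.
  by apply/existsP; exists p; apply/existsP; exists q; rewrite up uq.
have [qp pu qu] : [/\ G q p, G p u & G q u] by rewrite -(adj_sym G p q) -(adj_sym G u p) -(adj_sym G u q) pq up uq.
have nup := adj_neq up; have nuq := adj_neq uq.
have ctouch := card_touch free up uq pq.
(* Let t be the size of [touch G u v w]. Each y in it is far from u, so it has degree 1 and x y <=
   1, while x v >= -(2 + t); hence each of these t terms x v - x y is at least -(3 + t). *)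
have touchE v w : G u v -> G u w -> G v w ->
  a * x v >= (x v - d) + (x v - x w) - #|touch G u v w|%:R * (3 + #|touch G u v w|%:R).
  move=> uv uw vw; have vu : G v u by rewrite adj_sym.
  rewrite -xL /lap (sum_touch _ vu vw (adj_neq uw)).
  rewrite xu addrA lerD2l lerNl -sumrN mulr_natl -sumr_const; apply: ler_sum => y yt.
  have yfar : y \in far G u by apply: subsetP yt; apply: touch_far.
  have := xle y; rewrite (degree_far deg0 farE yfar) ler_norml => /andP[_ y1].
  have := xlo v; rewrite (degree_touch vu vw (adj_neq uw)) natrD; lra.
have ep := touchE p q up uq pq; have eq_ := touchE q p uq up qp.
have dp := degree_touch pu pq nuq; have dq := degree_touch qu qp nup.
have rest : - \sum_(v | G u v) x v <= (ndeg G u)%:R - (degree G p)%:R - (degree G q)%:R - x p - x q.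
  rewrite -ndegR (bigD1 p) //= (bigD1 q) /=; last by rewrite uq eq_sym (adj_neq pq).
  rewrite [in leRHS](bigD1 p) //= [in leRHS](bigD1 q) /=; last by rewrite uq eq_sym (adj_neq pq).
  have : - \sum_(v | G u v && (v != p) && (v != q)) x v <= \sum_(v | G u v && (v != p) && (v != q)) (degree G v)%:R.
    by rewrite -sumrN; apply: ler_sum.
  lra.
have SR : (ndeg G u)%:R = 2 * d + 1 by rewrite SE natrD natrM.
move: rest; rewrite SR dp dq !natrD => rest.
have aR : a > d + 2 by move: alt; rewrite nE addn3 /= -natr1 -natr1; lra.
(* As a > d + 2, the values at the neighbours of u sum to less than -2 d, while their degrees sum to
   only 2 d + 1; the neighbours other than p and q contribute at least minus their degrees. *)
have tl : - (x p + x q) > 3 + #|touch G u p q|%:R + #|touch G u q p|%:R.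
  have : a * d - d ^+ 2 > 2 * d by rewrite expr2 -mulrBl ltr_pM2r //; lra.
  by move: rest; lra.
have far2 : (#|far G u| <= 2)%N by move: cfar; rewrite nE addn3 /= -addn2 => /addnI->.
exact: critical_triangle_absurd (leq_trans ctouch far2) d3R aR ep eq_ tl.
Qed.

End UpperBound.

(** * Spectra of windmills with a pendant vertex *)

Lemma sum_option (R : nmodType) (T : finType) (P : pred (option T)) (F : option T -> R) :
  \sum_(o | P o) F o = (if P None then F None else 0) + \sum_(t | P (Some t)) F (Some t).
Proof.
rewrite big_mkcond (bigD1 None) //=; congr (_ + _).
rewrite [RHS]big_mkcond (reindex_omap Some id) /=; last by case.
by apply: eq_big => t //; rewrite eqxx.
Qed.

Lemma sum_constr (R : pzRingType) (T : finType) (c : R) : \sum_(i : T) c = #|T|%:R * c.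
Proof. by rewrite sumr_const mulr_natl. Qed.

Lemma natr_double_add (R : pzRingType) k m : (2 * k + m)%:R = 2 * k%:R + m%:R :> R.
Proof. by rewrite natrD natrM. Qed.

Section Eigenvectors.
Variable R : realType.

Lemma lap_pendant (V : finType) (G : sgraph V) p (x : option V -> R) u :
  lap (add_pendant G p) x (Some u) =
  (if u == p then x (Some u) - x None else 0) + lap G (x \o Some) u.
Proof. by rewrite /lap sum_option. Qed.

Lemma lap_pendant_new (V : finType) (G : sgraph V) p (x : option V -> R) :
  lap (add_pendant G p) x None = x None - x (Some p).
Proof. by rewrite /lap sum_option /= add0r big_pred1_eq. Qed.

Section WindmillLap.
Variables (k m : nat) (x : windmill_vertex k m -> R).
Let c := x (windmill_center k m).

Lemma lap_windmill_center :
  lap (windmill k m) x (windmill_center k m) =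
  (2 * k + m)%:R * c - (\sum_p x (inr (inl p)) + \sum_i x (inr (inr i))).
Proof.
rewrite /lap big_sumType /= big_pred0 => [|i]; last by rewrite (ord1 i).
rewrite add0r big_sumType /= !sumrB !sum_constr card_prod !card_ord natr_double_add natrM -/c.
by move: (\sum_p _) (\sum_i _) => S T; ring.
Qed.

Lemma lap_windmill_triangle i j :
  lap (windmill k m) x (inr (inl (i, j))) =
  2 * x (inr (inl (i, j))) - c - x (inr (inl (i, rev_ord j))).
Proof.
rewrite /lap big_sumType /= big_ord1 big_sumType /= big_pred0_eq addr0.
rewrite (big_pred1 (i, rev_ord j)) => [|[a b]]; first by rewrite /c /windmill_center; ring.
rewrite /= /copies_rel /complete_rel xpair_eqE /= eq_sym; congr andb.
by case: j b => [[|[|//]] ?] [[|[|//]] ?].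
Qed.

Lemma lap_windmill_leaf i :
  lap (windmill k m) x (inr (inr i)) = x (inr (inr i)) - c.
Proof.
by rewrite /lap big_sumType /= big_ord1 big_sumType /= !big_pred0_eq !addr0.
Qed.

End WindmillLap.

(** The function equal to n - 1 at the center and to -1 elsewhere attains the upper bound n. *)
Lemma mu_windmill k m : (0 < 2 * k + m)%N -> mu R (windmill k m) = (1 + 2 * k + m)%:R.
Proof.
move=> km; pose n : R := (1 + 2 * k + m)%:R.
pose x (v : windmill_vertex k m) : R := if v is inl _ then n - 1 else -1.
have nE : n = 1 + 2 * k%:R + m%:R by rewrite /n -addnA natrD natr_double_add addrA.
have kmR : 0 < (2 * k + m)%:R :> R by rewrite ltr0n.
have ex : eigenfun (windmill k m) n x.
  split; first by exists (windmill_center k m); rewrite /= nE; move: kmR; rewrite natr_double_add; lra.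
  case=> [i|[[i j]|i]]; rewrite /= ?(ord1 i).
  - rewrite lap_windmill_center /= !sum_constr card_prod !card_ord.
    by rewrite natr_double_add natrM nE; ring.
  - by rewrite lap_windmill_triangle /=; ring.
  - by rewrite lap_windmill_leaf /=; ring.
apply/eqP; rewrite eq_le (eigenfun_le_mu ex) andbT.
have [y ey] := mu_eigenfun R (windmill k m) (windmill_center k m).
by rewrite -card_windmill; apply: eigenfun_le_card ey.
Qed.

(* path_char and triangle_char are what remains of the eigenvalue equations of path_pendant and triangle_pendant at the
   center once all other values have been expressed through the value there, with denominators cleared; s is the number of
   vertices adjacent to the center that lie neither on the pendant path nor on the triangle carrying the extra pendant vertex. *)
Definition path_char (s l : R) : R :=
  (l - (s + 1)) * (l - 1) * (l ^+ 2 - 3 * l + 1) - s * (l ^+ 2 - 3 * l + 1) - (l - 1) ^+ 2.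

Definition triangle_char (s l : R) : R :=
  (l - (s + 2)) * (l - 1) * (l ^+ 3 - 6 * l ^+ 2 + 9 * l - 3) - s * (l ^+ 3 - 6 * l ^+ 2 + 9 * l - 3)
  - (2 * l ^+ 2 - 9 * l + 6) * (l - 1).

(** Polynomial versions of the two functions, to which the intermediate value theorem [poly_ivt]
    applies. *)
Definition path_charp (s : R) : {poly R} :=
  ('X - (s + 1)%:P) * ('X - 1%:P) * ('X ^+ 2 - 3%:P * 'X + 1%:P) - s%:P * ('X ^+ 2 - 3%:P * 'X + 1%:P) - ('X - 1%:P) ^+ 2.

Definition triangle_charp (s : R) : {poly R} :=
  ('X - (s + 2)%:P) * ('X - 1%:P) * ('X ^+ 3 - 6%:P * 'X ^+ 2 + 9%:P * 'X - 3%:P)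
  - s%:P * ('X ^+ 3 - 6%:P * 'X ^+ 2 + 9%:P * 'X - 3%:P) - (2%:P * 'X ^+ 2 - 9%:P * 'X + 6%:P) * ('X - 1%:P).

Lemma path_charpE s l : (path_charp s).[l] = path_char s l.
Proof. by rewrite /path_charp !(hornerD, hornerN, hornerM, horner_exp, hornerX, hornerC). Qed.

Lemma triangle_charpE s l : (triangle_charp s).[l] = triangle_char s l.
Proof. by rewrite /triangle_charp !(hornerD, hornerN, hornerM, horner_exp, hornerX, hornerC). Qed.

Lemma path_eigenfun k m (l : R) : 5 <= l -> path_char (2 * k + m)%:R l = 0 ->
  exists x, eigenfun (path_pendant k m) l x.
Proof.
move=> l5 ch; have q0 : l ^+ 2 - 3 * l + 1 != 0 by apply: lt0r_neq0; nra.
have l1 : l - 1 != 0 by apply: lt0r_neq0; lra.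
(* With value 1 at the center and equal values within each triangle, the equations at all other
   vertices force these values; the equation at the center is then [ch]. *)
pose x (v : option (option (windmill_vertex k m))) : R :=
  match v with
  | None => (l ^+ 2 - 3 * l + 1)^-1
  | Some None => - (l - 1) / (l ^+ 2 - 3 * l + 1)
  | Some (Some (inl _)) => 1
  | Some (Some (inr _)) => - (l - 1)^-1
  end.
exists x; split; first by exists (Some (Some (windmill_center k m))); rewrite /= oner_eq0.
case=> [[[i|[[i j]|i]]|]|]; rewrite ?lap_pendant ?lap_pendant_new /= ?(ord1 i) ?eqxx.
- rewrite add0r lap_windmill_center /= !sum_constr card_prod !card_ord.
  move: ch; rewrite /path_char natr_double_add natrM => ch.
  apply: (mulfI (mulf_neq0 l1 q0)); apply/eqP; rewrite eq_sym -subr_eq0; apply/eqP; rewrite -[RHS]ch; field.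
  by rewrite ?l1 ?q0.
- by rewrite !add0r lap_windmill_triangle /=; field.
- by rewrite !add0r lap_windmill_leaf /=; field.
- by field.
- by field.
Qed.


Lemma triangle_den_gt0 (l : R) : 5 <= l -> 0 < l ^+ 3 - 6 * l ^+ 2 + 9 * l - 3.
Proof.
move=> l5; have -> : l ^+ 3 - 6 * l ^+ 2 + 9 * l - 3 = l * (l - 3) ^+ 2 - 3 by ring.
have sq : 4 <= (l - 3) ^+ 2 by nra.
have : 5 * 4 <= l * (l - 3) ^+ 2 by apply: ler_pM.
by lra.
Qed.

Lemma triangle_eigenfun k m (l : R) : 5 <= l -> triangle_char (2 * k + m)%:R l = 0 ->
  exists x, eigenfun (triangle_pendant k m) l x.
Proof.
move=> l5 ch; have r0 : l ^+ 3 - 6 * l ^+ 2 + 9 * l - 3 != 0 by apply/lt0r_neq0/triangle_den_gt0.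
have l1 : l - 1 != 0 by apply: lt0r_neq0; lra.
pose r := l ^+ 3 - 6 * l ^+ 2 + 9 * l - 3.
(* The triangle [ord0] carries the extra pendant vertex at its end [ord0]; the other triangles are
   as in an ordinary windmill. *)
pose t (p : 'I_k.+1 * 'I_2) : R :=
  if p.1 == ord0 then if p.2 == ord0 then - (l - 1) * (l - 3) / r else - (l ^+ 2 - 5 * l + 3) / r
  else - (l - 1)^-1.
have tE : \sum_p t p = - (l - 1) * (l - 3) / r - (l ^+ 2 - 5 * l + 3) / r - 2 * k%:R * (l - 1)^-1.
  transitivity (\sum_i \sum_j t (i, j)); first by rewrite pair_bigA; apply: eq_bigr => -[].
  rewrite big_ord_recl !big_ord_recl big_ord0 /t /=.
  under eq_bigr do rewrite !big_ord_recl big_ord0 /=.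
  by rewrite sum_constr card_ord; ring.
pose x (v : option (windmill_vertex k.+1 m)) : R :=
  match v with
  | None => (l - 3) / r
  | Some (inl _) => 1
  | Some (inr (inl p)) => t p
  | Some (inr (inr _)) => - (l - 1)^-1
  end.
exists x; split; first by exists (Some (windmill_center k.+1 m)); rewrite /= oner_eq0.
have lapP := lap_pendant (windmill k.+1 m) (windmill_triangle_vertex k m) x.
case=> [[i|[[i j]|i]]|].
- rewrite lapP (ord1 i) /= add0r lap_windmill_center /=.
  rewrite tE sum_constr card_ord.
  move: ch; rewrite /triangle_char natr_double_add -/r => ch.
  have -> : (2 * k.+1 + m)%:R = 2 * (k%:R + 1) + m%:R :> R by rewrite natr_double_add natr1.
  apply: (mulfI (mulf_neq0 l1 r0)); apply/eqP; rewrite eq_sym -subr_eq0; apply/eqP; rewrite -[RHS]ch /r; field.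
  by rewrite ?l1 ?r0.
- rewrite lapP lap_windmill_triangle /= -[_ == windmill_triangle_vertex k m]/((i, j) == (ord0, ord0)) xpair_eqE.
  have [->|i0] := eqVneq i ord0; last by rewrite /t /= add0r (negbTE i0); field.
  by case: j => [[|[|//]] hj]; rewrite /t /= /r; field.
- by rewrite lapP lap_windmill_leaf /= add0r; field.
- by rewrite lap_pendant_new /= /t /= /r; field.
Qed.

Lemma path_eigenfun_char k m (l : R) x : 3 < l ->
  eigenfun (path_pendant k m) l x -> path_char (2 * k + m)%:R l = 0.
Proof.
move=> l3 [[u xu] xL].
pose w := x (Some (Some (windmill_center k m))); pose c := x (Some None); pose z := x None.
have Lz := xL None; rewrite lap_pendant_new -/c -/z in Lz.
have Lc := xL (Some None); rewrite lap_pendant lap_pendant_new eqxx /= -/c -/z -/w in Lc.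
have Lt i j := xL (Some (Some (inr (inl (i, j))))).
have {}Lt i j : 2 * x (Some (Some (inr (inl (i, j))))) - w - x (Some (Some (inr (inl (i, rev_ord j))))) =
    l * x (Some (Some (inr (inl (i, j))))).
  by rewrite -Lt !lap_pendant /= !add0r lap_windmill_triangle.
have Ll i : x (Some (Some (inr (inr i)))) - w = l * x (Some (Some (inr (inr i)))).
  by rewrite -xL !lap_pendant /= !add0r lap_windmill_leaf.
have Tt i j : (l - 1) * x (Some (Some (inr (inl (i, j))))) = - w.
  have L1 := Lt i j; have := Lt i (rev_ord j); rewrite rev_ordK => L2.
  (* Functions antisymmetric on a triangle have eigenvalue 3, so for l > 3 the two values on a
     triangle agree. *)
  have /eqP : (l - 3) * (x (Some (Some (inr (inl (i, j))))) - x (Some (Some (inr (inl (i, rev_ord j)))))) = 0.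
    by lra.
  by rewrite mulf_eq0 subr_eq0 gt_eqF //= => /eqP; lra.
have Tl i : (l - 1) * x (Some (Some (inr (inr i)))) = - w by have := Ll i; lra.
(* Every value is a multiple of [w], so [w] = 0 would make x vanish identically. *)
have w0 : w != 0.
  apply: contra_neq xu => w0; have l1 : l - 1 != 0 by apply: lt0r_neq0; lra.
  have c0 : c = 0.
    have : (l ^+ 2 - 3 * l + 1) * c = 0 by move: Lz Lc; rewrite w0; nra.
    by move/eqP; rewrite mulf_eq0 => /orP[/eqP|/eqP//]; nra.
  have z0 : z = 0 by apply: (mulfI l1); move: Lz; rewrite c0; lra.
  case: u => [[[i|[[i j]|i]]|]|] //.
  - by rewrite (ord1 i).
  - by apply: (mulfI l1); rewrite Tt w0 mulr0 oppr0.
  - by apply: (mulfI l1); rewrite Tl w0 mulr0 oppr0.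
have := xL (Some (Some (windmill_center k m))).
rewrite !lap_pendant lap_windmill_center /= add0r -/w -/c.
set S := \sum_p _ + _; have SE : (l - 1) * S = - ((2 * k + m)%:R * w).
  rewrite /S mulrDr !mulr_sumr (eq_bigr (fun=> - w)) => [|[i j] _]; last exact: Tt.
  rewrite (eq_bigr _ (fun i _ => Tl i)) !sum_constr card_prod !card_ord.
  by rewrite natr_double_add natrM; ring.
move=> Lw; apply: (mulIf w0); rewrite mul0r /path_char.
have cE : (l ^+ 2 - 3 * l + 1) * c = - (l - 1) * w by move: Lz Lc; nra.
set s : R := (2 * k + m)%:R in SE Lw *.
have -> : ((l - (s + 1)) * (l - 1) * (l ^+ 2 - 3 * l + 1) - s * (l ^+ 2 - 3 * l + 1) - (l - 1) ^+ 2) * w =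
  (l - 1) * (l ^+ 2 - 3 * l + 1) * (l * w - (w - c + (s * w - S)))
  - (l ^+ 2 - 3 * l + 1) * ((l - 1) * S + s * w) + (l - 1) * ((l - 1) * - w - (l ^+ 2 - 3 * l + 1) * c) by ring.
rewrite SE cE; rewrite -Lw; ring.
Qed.

(** [path_char] changes sign between n - 1 and n, where n = 2 k + m + 3 is the order of the
    graph. *)
Lemma path_mu_gt k m : (3 <= 2 * k + m)%N -> (2 * k + m + 2)%:R < mu R (path_pendant k m).
Proof.
move=> km; pose s : R := (2 * k + m)%:R; have s3 : 3 <= s by rewrite ler_nat.
have lo : path_char s (s + 2) < 0 by rewrite /path_char; nra.
have hi : 0 < path_char s (s + 3).
  have -> : path_char s (s + 3) = s * (s + 3) ^+ 2 by rewrite /path_char; ring.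
  by rewrite mulr_gt0 ?exprn_gt0 //; lra.
have [||l /andP[l2 l3]] := @poly_ivt _ (path_charp s) (s + 2) (s + 3); first lra.
  by rewrite !path_charpE (ltW lo) (ltW hi).
rewrite /root path_charpE => /eqP ch.
have l2' : s + 2 < l by rewrite lt_neqAle l2 andbT; apply: contraTneq lo => ->; rewrite ch ltxx.
have [|x ex] := path_eigenfun _ ch; first lra.
by rewrite natrD; apply: lt_le_trans (eigenfun_le_mu ex).
Qed.

Lemma path_mu_lt_triangle_mu k m : (1 <= 2 * k + m)%N ->
  mu R (path_pendant k.+1 m) < mu R (triangle_pendant k m.+1).
Proof.
move=> km; have := @path_mu_gt k.+1 m; set a := mu R _ => gta.
have {}gta := gta ltac:(lia).
pose s : R := (2 * k.+1 + m)%:R; have s3 : 3 <= s by rewrite ler_nat; lia.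
move: gta; rewrite natrD -/s => gta.
have [x ex] := mu_eigenfun R (path_pendant k.+1 m) None.
have ch : path_char s a = 0 by apply: path_eigenfun_char ex; rewrite -/a; lra.
have q0 : 0 < a ^+ 2 - 3 * a + 1 by nra.
(* This identity decides the comparison of the two graphs: it forces a root of triangle_char beyond any root of path_char. *)
have key : (a ^+ 2 - 3 * a + 1) * triangle_char (s - 1) a =
    (a ^+ 3 - 6 * a ^+ 2 + 9 * a - 3) * path_char s a - a ^+ 2.
  by rewrite /triangle_char /path_char; ring.
have lo : triangle_char (s - 1) a < 0.
  by rewrite -(pmulr_rlt0 _ q0) key ch mulr0 sub0r oppr_lt0; nra.
have sE : (2 * k + m.+1)%:R = s - 1 :> R.
  by rewrite /s (_ : 2 * k.+1 + m = (2 * k + m.+1) + 1)%N ?natrD ?addrK //; lia.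
(* s + 3 is the common order of the two graphs, hence an upper bound of [a]; a root of
   [triangle_char] therefore lies above [a]. *)
have hi : 0 < triangle_char (s - 1) (s + 3).
  have -> : triangle_char (s - 1) (s + 3) = (s + 3) ^+ 2 * ((s + 1) * (s - 1)) by rewrite /triangle_char; ring.
  by rewrite !mulr_gt0 ?exprn_gt0 //; lra.
have a_le : a <= s + 3.
  apply: le_trans (eigenfun_le_card ex) _.
  by rewrite !card_option card_windmill /s -natrD ler_nat; lia.
have [||l /andP[l2 l3]] := @poly_ivt _ (triangle_charp (s - 1)) a (s + 3) => //.
  by rewrite !triangle_charpE (ltW lo) (ltW hi).
rewrite /root triangle_charpE => /eqP chl.
have l2' : a < l by rewrite lt_neqAle l2 andbT; apply: contraTneq lo => ->; rewrite chl ltxx.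
have [||y ey] := @triangle_eigenfun k m.+1 l; rewrite ?sE //; first lra.
exact: lt_le_trans (eigenfun_le_mu ey).
Qed.

(** The complement is connected: the new vertex misses all but p, and a leaf misses both p and the
    new vertex. An eigenfunction for n would thus be constant with sum 0. *)
Lemma triangle_mu_lt k m : (0 < m)%N ->
  mu R (triangle_pendant k m) < (2 * k.+1 + m + 2)%:R.
Proof.
move=> m0; have cardE : (2 * k.+1 + m + 2)%N = #|{: option (windmill_vertex k.+1 m)}|.
  by rewrite card_option card_windmill; lia.
have [x ex] := mu_eigenfun R (triangle_pendant k m) None.
rewrite lt_neqAle cardE (eigenfun_le_card ex) andbT; apply/eqP => E; rewrite E in ex.
have same := eigenfun_card_nonadj ex; have [[u xu] _] := ex.
pose c : windmill_vertex k.+1 m := windmill_center k.+1 m.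
pose p := windmill_triangle_vertex k m; pose l : windmill_vertex k.+1 m := inr (inr (Ordinal m0)).
have const v : x v = x None.
  have lN : x (Some l) = x None by apply: same.
  case: v => [v|//]; have [->|vp] := eqVneq v p; first by rewrite -lN; apply: same.
  by apply: same; rewrite /= -/p.
have n0 : #|{: option (windmill_vertex k.+1 m)}|%:R != 0 :> R by rewrite pnatr_eq0 card_option.
have := eigenfun_sum0 n0 ex; rewrite (eq_bigr _ (fun v _ => const v)) big_const iter_addr addr0.
move/eqP; rewrite -mulr_natl mulf_eq0 (negbTE n0) /= -(const u).
by rewrite (negbTE xu).
Qed.

End Eigenvectors.

(* The equality case and the orderings *)
Local Close Scope ring_scope.

(** Vertices with different values are adjacent. If u shares its value with some u', then v and any
    other vertex with the value of v would be two common neighbours of u and u'. So u or v is alone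
    with its value, hence adjacent to all others. *)
Lemma eigenfun_card_universal (R : realType) (V : finType) (G : sgraph V) (x : V -> R) :
  C4_free G -> eigenfun G #|V|%:R%R x -> exists w, #|V|.-1 <= degree G w.
Proof.
move=> free ex; have same := eigenfun_card_nonadj ex; have [[u xu] _] := ex.
have adj_diff a b : x a != x b -> G a b.
  by move=> ab; apply/negPn/negP => /same E; rewrite E eqxx in ab.
have full w : (forall v, v != w -> x v != x w) -> #|V|.-1 <= degree G w.
  move=> dw; rewrite -(cardC1 w) /degree subset_leq_card //.
  by apply/subsetP => v; rewrite !inE => /dw vw; apply: adj_diff; rewrite eq_sym.
have n0 : (#|V|%:R != 0 :> R)%R by rewrite pnatr_eq0 -lt0n; apply/card_gt0P; exists u.
have [/existsP[v vu]|const] := boolP [exists v, x v != x u]; last first.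
  have {}const v : x v = x u by apply/eqP; move: const; rewrite negb_exists => /forallP/(_ v)/negPn.
  have := eigenfun_sum0 n0 ex; rewrite (eq_bigr _ (fun v _ => const v)) sum_constr.
  by move/eqP; rewrite mulf_eq0 (negbTE n0) (negbTE xu).
have [/existsP[u' /andP[uu' /eqP xu']]|nou] := boolP [exists u', (u != u') && (x u' == x u)]; last first.
  exists u; apply: full => w wu; apply: contra nou => xw.
  by apply/existsP; exists w; rewrite eq_sym wu.
exists v; apply: full => w wv; apply/negP => /eqP xw.
case/eqP: wv; apply: (C4_free_common free uu').
all: by apply: adj_diff; rewrite ?xu' ?xw eq_sym.
Qed.

(** Treats the unicyclic and bicyclic orderings together. A vertex of degree at least n - 2 would
    make G one of the three excluded graphs, so n - 1 separates [mu R G] from the rest. *)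
Lemma kcyclic_mu_ordering (R : realType) (V : finType) (G : sgraph V) (k m : nat) :
  #|V| = 2 * k.+1 + m + 3 -> 0 < m -> kcyclic k.+1 G -> C4_free G ->
  ~ iso G (windmill k.+1 m.+2) -> ~ iso G (triangle_pendant k m.+1) ->
  ~ iso G (path_pendant k.+1 m) ->
  [/\ (mu R G < mu R (path_pendant k.+1 m))%R,
      (mu R (path_pendant k.+1 m) < mu R (triangle_pendant k m.+1))%R &
      (mu R (triangle_pendant k m.+1) < mu R (windmill k.+1 m.+2))%R].
Proof.
move=> nE m0 cyc free noW noT noP.
have sumG := kcyclic_sum_degree cyc.
have deg0 u : 0 < degree G u by apply: connected_degree_gt0 cyc.1; lia.
split; last 2 first.
- by apply: path_mu_lt_triangle_mu; lia.
- have -> : mu R (windmill k.+1 m.+2) = (2 * k.+1 + m.+1 + 2)%:R%R.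
    by rewrite mu_windmill; [congr (_%:R)%R|]; lia.
  exact: triangle_mu_lt.
have degD u : degree G u <= #|V| - 3.
  rewrite leqNgt; apply/negP => du.
  have [d1|d1] := leqP #|V|.-1 (degree G u).
    apply: noW; have := iso_windmill free sumG _ d1.
    rewrite /Gnk (_ : #|V| - 2 * k.+1 - 1 = m.+2); last lia.
    by apply; lia.
  have d2 : degree G u = #|V| - 2 by lia.
  have := iso_triangle_or_path_pendant free sumG _ deg0 d2.
  rewrite (_ : #|V| - 2 * k.+1 - 2 = m.+1); last lia.
  rewrite (_ : #|V| - 2 * k.+1 - 3 = m); last lia.
  by case=> //; lia.
have [u0 _] : exists u : V, u \in V by apply/card_gt0P; rewrite nE; lia.
have [x ex] := mu_eigenfun R G u0.
apply: (@le_lt_trans _ _ (2 * k.+1 + m + 2)%:R%R); last by apply: path_mu_gt; lia.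
rewrite (_ : 2 * k.+1 + m + 2 = #|V|.-1); last lia.
by apply: eigenvalue_le_max_degree sumG deg0 degD _ _ ex => //; rewrite nE; lia.
Qed.

Theorem mainTheorem4 (R : realType) :
  (forall (k n : nat) (V : finType) (G : sgraph V),
     (1 <= k)%N -> (2 * k + 2 <= n)%N ->
     #|V| = n -> kcyclic k G -> C4_free G ->
     (mu R G <= mu R (Gnk n k))%R /\
     (mu R G = mu R (Gnk n k) <-> iso G (Gnk n k)))
  /\
  (forall (n : nat) (V : finType) (G : sgraph V),
     (6 <= n)%N -> #|V| = n -> kcyclic 1 G -> C4_free G ->
     ~ iso G (G1 n) -> ~ iso G (G2 n) -> ~ iso G (G3 n) ->
     [/\ (mu R G < mu R (G3 n))%R,
         (mu R (G3 n) < mu R (G2 n))%R &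
         (mu R (G2 n) < mu R (G1 n))%R])
  /\
  (forall (n : nat) (V : finType) (G : sgraph V),
     (8 <= n)%N -> #|V| = n -> kcyclic 2 G -> C4_free G ->
     ~ iso G (G4 n) -> ~ iso G (G5 n) -> ~ iso G (G6 n) ->
     [/\ (mu R G < mu R (G6 n))%R,
         (mu R (G6 n) < mu R (G5 n))%R &
         (mu R (G5 n) < mu R (G4 n))%R]).
Proof.
split; [|split].
- move=> k n V G k1 nk nE cyc free.
  have muW : mu R (Gnk n k) = #|V|%:R%R.
    by rewrite mu_windmill ?nE; [congr (_%:R)%R|]; lia.
  have [u0 _] : exists u : V, u \in V by apply/card_gt0P; rewrite nE; lia.
  have [x ex] := mu_eigenfun R G u0.
  rewrite muW; split; first exact: eigenfun_le_card ex.
  split=> [E|/iso_mu->//]; rewrite E in ex.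
  have [w dw] := eigenfun_card_universal free ex.
  by rewrite -nE; apply: (iso_windmill free (kcyclic_sum_degree cyc) _ dw); rewrite nE; lia.
- move=> n V G n6 nE cyc free; rewrite /G1 /Gnk /G2 /G3.
  have -> : n - 2 * 1 - 1 = (n - 5).+2 by lia.
  have -> : n - 4 = (n - 5).+1 by lia.
  by apply: kcyclic_mu_ordering => //; lia.
- move=> n V G n8 nE cyc free; rewrite /G4 /Gnk /G5 /G6.
  have -> : n - 2 * 2 - 1 = (n - 7).+2 by lia.
  have -> : n - 6 = (n - 7).+1 by lia.
  by apply: kcyclic_mu_ordering => //; lia.
Qed.
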